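(* Let $\mathbf{k}$ be a commutative unital ring, $\lambda\in\mathbf{k}$, and let $(A,\mu,\Delta)$ be an infinitesimal bialgebra of weight $\lambda$ over $\mathbf{k}$ with $A^*\otimes A^*\cong (A\otimes A)^*$ as modules, where $A^*=\mathrm{Hom}_{\mathbf{k}}(A,\mathbf{k})$. Then the dual space $A^*$ is an infinitesimal bialgebra of weight $\lambda$ with the multiplication $$A^*\otimes A^*\cong (A\otimes A)^*\xrightarrow{\ \Delta^*\ }A^*$$ and the coproduct $$A^*\xrightarrow{\ \mu^*\ }(A\otimes A)^*\cong A^*\otimes A^*.$$
   Context: All modules, tensor products and linear maps are over the commutative unital ring $\mathbf{k}$. An algebra is an associative algebra, possibly without unit; a coalgebra is a coassociative coalgebra, possibly without counit. For an algebra $A$, $A\otimes A$ is an $A$-bimodule via $a\cdot(b\otimes c)=ab\otimes c$ and $(b\otimes c)\cdot a=b\otimes ca$. An infinitesimal bialgebra of weight $\lambda$ is a triple $(A,\mu,\Delta)$ with $(A,\mu)$ an algebra and $(A,\Delta)$ a coalgebra such that $\Delta(ab)=a\cdot\Delta(b)+\Delta(a)\cdot b+\lambda(a\otimes b)$ for all $a,b\in A$. Here $\Delta^*:(A\otimes A)^*\to A^*$ and $\mu^*:A^*\to(A\otimes A)^*$ denote the transposes of $\Delta:A\to A\otimes A$ and $\mu:A\otimes A\to A$.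
   Formalization: The isomorphism A*⊗A* ≅ (A⊗A)* is taken to be the canonical map, and the canonical map A*⊗A*⊗A* → (A⊗A⊗A)* is additionally assumed injective; without this, coassociativity of the dual can fail over a general ring (it is automatic over fields). *)

(* Defs.v *)
From HB Require Import structures.
From mathcomp Require Import all_boot ssralg.
From mathcomp Require Import boolp.

Set Implicit Arguments.
Unset Strict Implicit.
Unset Printing Implicit Defensive.

Import GRing.Theory.
Local Open Scope ring_scope.
Local Open Scope quotient_scope.

(* [pzRingType] and not [nzRingType]: the ground ring may be trivial. *)
Definition bilin (k : comPzRingType) (M N P : lmodType k) (b : M -> N -> P) :
    Prop :=
  (forall y, linear (b^~ y)) /\ (forall x, linear (b x)).

Section TensorProduct.
Variables (k : comPzRingType) (M N : lmodType k).

(* The list [:: (x1, y1); ...; (xn, yn)] stands for x1 ⊗ₜ y1 + ... + xn ⊗ₜ yn: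
   the scalars of a formal linear combination are absorbed by the first
   factors.  [tensor_eq] is the least congruence of commutative monoids making
   (x, y) |-> x ⊗ₜ y additive in each variable and balanced; [tens_bilin],
   [tliftE] and [tlift_unique] below give the universal property of the
   quotient. *)
Inductive tensor_eq : seq (M * N) -> seq (M * N) -> Prop :=
| TensorRefl s : tensor_eq s s
| TensorSym s t : tensor_eq s t -> tensor_eq t s
| TensorTrans s t u : tensor_eq s t -> tensor_eq t u -> tensor_eq s u
| TensorCat s s' t t' :
    tensor_eq s s' -> tensor_eq t t' -> tensor_eq (s ++ t) (s' ++ t')
| TensorComm s t : tensor_eq (s ++ t) (t ++ s)
| Tensor0l y : tensor_eq [:: (0, y)] [::]
| TensorDl x x' y : tensor_eq [:: (x + x', y)] [:: (x, y); (x', y)]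
| TensorDr x y y' : tensor_eq [:: (x, y + y')] [:: (x, y); (x, y')]
| TensorZ a x y : tensor_eq [:: (a *: x, y)] [:: (x, a *: y)].

Definition tensor_eqb : rel (seq (M * N)) := fun s t => `[< tensor_eq s t >].

Lemma tensor_eqb_refl : reflexive tensor_eqb.
Proof. by move=> s; apply/asboolP; exact: TensorRefl. Qed.

Lemma tensor_eqb_sym : symmetric tensor_eqb.
Proof. by move=> s t; apply/asboolP/asboolP => /TensorSym. Qed.

Lemma tensor_eqb_trans : transitive tensor_eqb.
Proof.
by move=> t s u /asboolP st /asboolP tu; apply/asboolP; apply: TensorTrans tu.
Qed.

Canonical tensor_equiv :=
  EquivRel tensor_eqb tensor_eqb_refl tensor_eqb_sym tensor_eqb_trans.

Definition tensor : Type := {eq_quot tensor_equiv}.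
HB.instance Definition _ := Choice.on tensor.

Definition tclass (s : seq (M * N)) : tensor := \pi_{eq_quot tensor_equiv} s.
Definition trepr (t : tensor) : seq (M * N) := repr t.

Lemma treprK : cancel trepr tclass.
Proof. exact: reprK. Qed.

Lemma tclassP s t : tclass s = tclass t <-> tensor_eq s t.
Proof.
split=> [/(@eqmodP _ tensor_equiv)/asboolP //|st].
by apply/(@eqmodP _ tensor_equiv)/asboolP.
Qed.

Lemma tclassK s : tensor_eq (trepr (tclass s)) s.
Proof. by apply/tclassP; rewrite treprK. Qed.

Lemma tclass_ind (P : tensor -> Prop) :
  (forall s, P (tclass s)) -> forall t, P t.
Proof. by move=> Ps t; rewrite -(treprK t). Qed.

Definition tadd (t u : tensor) : tensor := tclass (trepr t ++ trepr u).

Definition tscale_seq (a : k) (s : seq (M * N)) : seq (M * N) :=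
  [seq (a *: p.1, p.2) | p <- s].

Definition tscale (a : k) (t : tensor) : tensor :=
  tclass (tscale_seq a (trepr t)).

Lemma tscale_seq_eq a s t :
  tensor_eq s t -> tensor_eq (tscale_seq a s) (tscale_seq a t).
Proof.
elim=> {s t}.
- by move=> *; exact: TensorRefl.
- by move=> s t _ /TensorSym.
- by move=> s t u _ st _; exact: TensorTrans.
- by move=> s s' t t' _ ss' _ tt'; rewrite /tscale_seq !map_cat; exact: TensorCat.
- by move=> s t; rewrite /tscale_seq !map_cat; exact: TensorComm.
- by move=> y /=; rewrite scaler0; exact: Tensor0l.
- by move=> x x' y /=; rewrite scalerDr; exact: TensorDl.
- by move=> x y y' /=; exact: TensorDr.
- move=> b x y /=; rewrite scalerA mulrC -scalerA; exact: TensorZ.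
Qed.

Lemma taddE s t : tadd (tclass s) (tclass t) = tclass (s ++ t).
Proof. by apply/tclassP; apply: TensorCat; exact: tclassK. Qed.

Lemma tscaleE a s : tscale a (tclass s) = tclass (tscale_seq a s).
Proof. by apply/tclassP; apply: tscale_seq_eq; exact: tclassK. Qed.

Lemma taddA : associative tadd.
Proof.
elim/tclass_ind=> s; elim/tclass_ind=> t; elim/tclass_ind=> u.
by rewrite !taddE catA.
Qed.

Lemma taddC : commutative tadd.
Proof.
elim/tclass_ind=> s; elim/tclass_ind=> t.
by rewrite !taddE; apply/tclassP; exact: TensorComm.
Qed.

Lemma tadd0 : left_id (tclass [::]) tadd.
Proof. by elim/tclass_ind=> s; rewrite taddE. Qed.

Lemma tclass_cons p s : tclass (p :: s) = tadd (tclass [:: p]) (tclass s).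
Proof. by rewrite taddE. Qed.

Lemma tscaleA a b t : tscale a (tscale b t) = tscale (a * b) t.
Proof.
elim/tclass_ind: t => s; rewrite !tscaleE /tscale_seq -map_comp.
by congr tclass; apply: eq_map => p /=; rewrite scalerA.
Qed.

Lemma tscale1 : left_id 1 tscale.
Proof.
elim/tclass_ind=> s; rewrite tscaleE; congr tclass.
by elim: s => //= -[x y] s ->; rewrite scale1r.
Qed.

Lemma tscaleDr : right_distributive tscale tadd.
Proof.
move=> a; elim/tclass_ind=> s; elim/tclass_ind=> t.
by rewrite !(taddE, tscaleE) /tscale_seq map_cat.
Qed.

Lemma tscaleDl t : {morph tscale^~ t : a b / a + b >-> tadd a b}.
Proof.
move=> a b /=; elim/tclass_ind: t => s; rewrite !tscaleE taddE.
elim: s => [|[x y] s IHs]; first by rewrite -taddE tadd0.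
have cE c : tclass (tscale_seq c ((x, y) :: s)) =
    tadd (tclass [:: (c *: x, y)]) (tclass (tscale_seq c s)).
  exact: tclass_cons.
rewrite -taddE; rewrite -taddE in IHs; rewrite !cE IHs.
have -> : tclass [:: ((a + b) *: x, y)] =
    tadd (tclass [:: (a *: x, y)]) (tclass [:: (b *: x, y)]).
  by rewrite taddE scalerDl; apply/tclassP; exact: TensorDl.
rewrite -!taddA; congr tadd.
by rewrite !taddA; congr tadd; exact: taddC.
Qed.

Lemma tscale0 t : tscale 0 t = tclass [::].
Proof.
elim/tclass_ind: t => s; rewrite tscaleE; elim: s => //= -[x y] s IHs.
rewrite tclass_cons IHs /= scale0r taddC tadd0.
by apply/tclassP; exact: Tensor0l.
Qed.

Lemma taddN : left_inverse (tclass [::]) (tscale (-1)) tadd.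
Proof. by move=> t; rewrite -{2}[t]tscale1 -tscaleDl addNr tscale0. Qed.

HB.instance Definition _ := GRing.isZmodule.Build tensor taddA taddC tadd0 taddN.
HB.instance Definition _ :=
  GRing.Zmodule_isLmodule.Build k tensor tscaleA tscale1 tscaleDr tscaleDl.

Definition tens (x : M) (y : N) : tensor := tclass [:: (x, y)].

Lemma tens_bilin : bilin tens.
Proof.
split=> [y a x x'|x a y y'].
  have -> : a *: tens x y = tens (a *: x) y by exact: tscaleE.
  have -> : tens (a *: x) y + tens x' y =
    tclass [:: (a *: x, y); (x', y)] by exact: taddE.
  by apply/tclassP; exact: TensorDl.
have -> : a *: tens x y = tens (a *: x) y by exact: tscaleE.
have -> : tens (a *: x) y = tens x (a *: y) by apply/tclassP; exact: TensorZ.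
have -> : tens x (a *: y) + tens x y' =
  tclass [:: (x, a *: y); (x, y')] by exact: taddE.
by apply/tclassP; exact: TensorDr.
Qed.

HB.instance Definition _ (x : M) :=
  GRing.isLinear.Build k N tensor *:%R (tens x) (tens_bilin.2 x).

Definition tensr (y : N) (x : M) : tensor := tens x y.

HB.instance Definition _ (y : N) :=
  GRing.isLinear.Build k M tensor *:%R (tensr y) (tens_bilin.1 y).

Lemma tensor_sum (t : tensor) : t = \sum_(p <- trepr t) tens p.1 p.2.
Proof.
rewrite -{1}[t]treprK; elim: (trepr t) => [|[x y] s IHs]; first by rewrite big_nil.
by rewrite big_cons tclass_cons IHs.
Qed.

Section Lift.
Variables (P : lmodType k) (b : M -> N -> P).

Definition tlift_seq (s : seq (M * N)) : P := \sum_(p <- s) b p.1 p.2.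

Definition tlift of bilin b := fun t : tensor => tlift_seq (trepr t).

Hypothesis bB : bilin b.

Let b0l y : b 0 y = 0.
Proof. by have := bB.1 y (-1) 0 0; rewrite scaler0 add0r scaleN1r addNr. Qed.

Let b0r x : b x 0 = 0.
Proof. by have := bB.2 x (-1) 0 0; rewrite scaler0 add0r scaleN1r addNr. Qed.

Lemma tlift_seq_eq s t : tensor_eq s t -> tlift_seq s = tlift_seq t.
Proof.
rewrite /tlift_seq; elim=> {s t}.
- by [].
- by move=> s t _ ->.
- by move=> s t u _ -> _ ->.
- by move=> s s' t t' _ ss' _ tt'; rewrite !big_cat /= ss' tt'.
- by move=> s t; rewrite !big_cat /= addrC.
- by move=> y; rewrite big_seq1 big_nil b0l.
- move=> x x' y; rewrite big_seq1 big_cons big_seq1 /=.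
  by have := bB.1 y 1 x x'; rewrite /= !scale1r.
- move=> x y y'; rewrite big_seq1 big_cons big_seq1 /=.
  by have := bB.2 x 1 y y'; rewrite /= !scale1r.
- move=> a x y; rewrite !big_seq1 /=.
  have := bB.1 y a x 0; have := bB.2 x a y 0.
  by rewrite /= !addr0 b0l b0r !addr0 => -> ->.
Qed.

Lemma tlift_class s : tlift bB (tclass s) = tlift_seq s.
Proof. exact: tlift_seq_eq (tclassK s). Qed.

Lemma tlift_linear : linear (tlift bB).
Proof.
move=> a; elim/tclass_ind=> s; elim/tclass_ind=> t.
have -> : a *: tclass s + tclass t = tclass (tscale_seq a s ++ t).
  by rewrite -taddE -tscaleE.
rewrite !tlift_class /tlift_seq big_cat big_map scaler_sumr /=; congr (_ + _).
apply: eq_bigr => -[x y] _ /=.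
by have := bB.1 y a x 0; rewrite !addr0 b0l addr0.
Qed.

HB.instance Definition _ :=
  GRing.isLinear.Build k tensor P *:%R (tlift bB) tlift_linear.

Lemma tliftE x y : tlift bB (tens x y) = b x y.
Proof. by rewrite tlift_class /tlift_seq big_seq1. Qed.

End Lift.

Lemma tlift_unique (P : lmodType k) (f g : {linear tensor -> P}) :
  (forall x y, f (tens x y) = g (tens x y)) -> f =1 g.
Proof.
move=> fg t; rewrite [t]tensor_sum !linear_sum.
by apply: eq_bigr => p _; exact: fg.
Qed.

End TensorProduct.

Arguments tens {k M N} x y.
Arguments tensr {k M N} y x.
Arguments tens_bilin {k M N}.
Arguments tlift {k M N P b} bB.
Arguments tlift_unique {k M N P f g}.

Notation "M ⊗ N" := (tensor M N) (at level 40, left associativity).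
Notation "x ⊗ₜ y" := (tens x y) (at level 40, left associativity).

Section TensorMaps.
Variable k : comPzRingType.

Lemma tmap_bilin (M M' N N' : lmodType k)
    (f : {linear M -> M'}) (g : {linear N -> N'}) :
  bilin (fun x y => f x ⊗ₜ g y).
Proof.
split=> [y a x x'|x a y y']; rewrite /= linearP; first exact: tens_bilin.1.
exact: tens_bilin.2.
Qed.

Definition tmap (M M' N N' : lmodType k)
    (f : {linear M -> M'}) (g : {linear N -> N'}) : M ⊗ N -> M' ⊗ N' :=
  tlift (tmap_bilin f g).

HB.instance Definition _ (M M' N N' : lmodType k)
    (f : {linear M -> M'}) (g : {linear N -> N'}) :=
  GRing.Linear.on (tmap f g).

Lemma tassoc1_bilin (M N P : lmodType k) (z : P) :
  bilin (fun (x : M) (y : N) => x ⊗ₜ (y ⊗ₜ z)).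
Proof.
split=> [y a x x'|x a y y'] /=; first exact: tens_bilin.1.
by rewrite (tens_bilin.1 z) (tens_bilin.2 x).
Qed.

Lemma tassoc_bilin (M N P : lmodType k) :
  bilin (fun (t : M ⊗ N) (z : P) => tlift (@tassoc1_bilin M N P z) t).
Proof.
split=> [z a t t'|t a z z'] /=; first exact: linearP.
move: t; apply: (@tlift_unique _ _ _ _ _
  (a \*: tlift (tassoc1_bilin M N z) \+ tlift (tassoc1_bilin M N z'))).
by move=> x y; rewrite /= !tliftE (tens_bilin.2 y) (tens_bilin.2 x).
Qed.

Definition tassoc (M N P : lmodType k) : M ⊗ N ⊗ P -> M ⊗ (N ⊗ P) :=
  tlift (@tassoc_bilin M N P).

HB.instance Definition _ (M N P : lmodType k) :=
  GRing.Linear.on (@tassoc M N P).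

Lemma tmapE (M M' N N' : lmodType k)
    (f : {linear M -> M'}) (g : {linear N -> N'}) x y :
  tmap f g (x ⊗ₜ y) = f x ⊗ₜ g y.
Proof. exact: tliftE. Qed.

Lemma tassocE (M N P : lmodType k) (x : M) (y : N) (z : P) :
  tassoc (x ⊗ₜ y ⊗ₜ z) = x ⊗ₜ (y ⊗ₜ z).
Proof. by rewrite /tassoc !tliftE. Qed.

End TensorMaps.

Arguments tassoc {k M N P}.

Section Dual.
Variables (k : comPzRingType) (M : lmodType k).

Definition dual : Type := {linear M -> k^o}.
Identity Coercion dual_linear : dual >-> GRing.Linear.type.

HB.instance Definition _ := gen_eqMixin dual.
HB.instance Definition _ := gen_choiceMixin dual.

Lemma dualP (f g : dual) : f =1 g -> f = g.
Proof.
move=> fg; have {fg} : f = g :> (M -> k^o) by apply/funext.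
case: f g => [f [[fA] [fB]]] [g [[gA] [gB]]] /= fg.
subst g; congr GRing.Linear.Pack; congr GRing.Linear.Class;
  by [congr Algebra.isNmodMorphism.Axioms_; exact: Prop_irrelevance
     |congr GRing.isScalable.Axioms_; exact: Prop_irrelevance].
Qed.

Definition dzero : dual := (\0 : {linear M -> k^o}).
Definition dopp (f : dual) : dual := (\- f : {linear M -> k^o}).
Definition dadd (f g : dual) : dual := (f \+ g : {linear M -> k^o}).
Definition dscale (a : k) (f : dual) : dual := (a \*: f : {linear M -> k^o}).

Lemma daddA : associative dadd.
Proof. by move=> f g h; apply: dualP => x; exact: addrA. Qed.
Lemma daddC : commutative dadd.
Proof. by move=> f g; apply: dualP => x; exact: addrC. Qed.
Lemma dadd0 : left_id dzero dadd.
Proof. by move=> f; apply: dualP => x; exact: add0r. Qed.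
Lemma daddN : left_inverse dzero dopp dadd.
Proof. by move=> f; apply: dualP => x; exact: addNr. Qed.

HB.instance Definition _ := GRing.isZmodule.Build dual daddA daddC dadd0 daddN.

Lemma dscaleA a b f : dscale a (dscale b f) = dscale (a * b) f.
Proof. by apply: dualP => x; exact: scalerA. Qed.
Lemma dscale1 : left_id 1 dscale.
Proof. by move=> f; apply: dualP => x; exact: scale1r. Qed.
Lemma dscaleDr : right_distributive dscale +%R.
Proof. by move=> a f g; apply: dualP => x; exact: scalerDr. Qed.
Lemma dscaleDl f : {morph dscale^~ f : a b / a + b}.
Proof. by move=> a b; apply: dualP => x; exact: scalerDl. Qed.

HB.instance Definition _ :=
  GRing.Zmodule_isLmodule.Build k dual dscaleA dscale1 dscaleDr dscaleDl.

End Dual.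

Section DualMaps.
Variable k : comPzRingType.

Definition transpose (M N : lmodType k) (u : {linear M -> N})
    (f : dual N) : dual M := (f \o u : {linear M -> k^o}).

Lemma transpose_linear (M N : lmodType k) (u : {linear M -> N}) :
  linear (transpose u).
Proof. by move=> a f g; apply: dualP. Qed.

HB.instance Definition _ (M N : lmodType k) (u : {linear M -> N}) :=
  GRing.isLinear.Build k (dual N) (dual M) *:%R (transpose u)
    (transpose_linear u).

Lemma dual_tens_bilin1 (M N : lmodType k) (f : dual M) (g : dual N) :
  @bilin k M N k^o (fun x y => f x * g y).
Proof.
split=> [y a x x'|x a y y'] /=; rewrite linearP.
  by rewrite mulrDl -mulrA.
by rewrite mulrDr mulrCA.
Qed.

Lemma dual_tens_bilin (M N : lmodType k) :
  bilin (fun (f : dual M) (g : dual N) =>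
           tlift (dual_tens_bilin1 f g) : dual (M ⊗ N)).
Proof.
split=> [g a f f'|f a g g']; apply: dualP.
- apply: (@tlift_unique _ _ _ _ _
    (a \*: tlift (dual_tens_bilin1 f g) \+ tlift (dual_tens_bilin1 f' g))).
  by move=> x y; rewrite /= !tliftE mulrDl -mulrA.
- apply: (@tlift_unique _ _ _ _ _
    (a \*: tlift (dual_tens_bilin1 f g) \+ tlift (dual_tens_bilin1 f g'))).
  by move=> x y; rewrite /= !tliftE mulrDr mulrCA.
Qed.

Definition dual_tens (M N : lmodType k) : dual M ⊗ dual N -> dual (M ⊗ N) :=
  tlift (@dual_tens_bilin M N).

HB.instance Definition _ (M N : lmodType k) :=
  GRing.Linear.on (@dual_tens M N).

Lemma dual_tensE (M N : lmodType k) (f : dual M) (g : dual N) x y :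
  dual_tens (f ⊗ₜ g) (x ⊗ₜ y) = f x * g y.
Proof. by rewrite /dual_tens tliftE; exact: (tliftE (dual_tens_bilin1 f g)). Qed.

(* Over a general ring the injectivity of this map is not a consequence of the
   bijectivity of [dual_tens M M]; it is what transports coassociativity from
   dual (A ⊗ A ⊗ A) back to dual A ⊗ dual A ⊗ dual A. *)
Definition dual_tens3 (M N P : lmodType k) :
    dual M ⊗ dual N ⊗ dual P -> dual (M ⊗ N ⊗ P) :=
  @dual_tens (M ⊗ N) P \o tmap (@dual_tens M N) idfun.

HB.instance Definition _ (M N P : lmodType k) :=
  GRing.Linear.on (@dual_tens3 M N P).

Lemma dual_tens3E (M N P : lmodType k) (f : dual M) (g : dual N) (h : dual P)
    x y z :
  dual_tens3 (f ⊗ₜ g ⊗ₜ h) (x ⊗ₜ y ⊗ₜ z) = f x * g y * h z.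
Proof. by rewrite /dual_tens3 /= tmapE !dual_tensE. Qed.

End DualMaps.

Arguments dual_tens {k} M N.
Arguments dual_tens3 {k} M N P.

Section InfinitesimalBialgebra.
Variables (k : comPzRingType) (A : lmodType k).
Variables (mu : {linear A ⊗ A -> A}) (Delta : {linear A -> A ⊗ A}).

Definition mul_assoc : Prop :=
  forall a b c : A, mu (mu (a ⊗ₜ b) ⊗ₜ c) = mu (a ⊗ₜ mu (b ⊗ₜ c)).

Definition comul_coassoc : Prop :=
  forall a : A,
    tassoc (tmap Delta idfun (Delta a)) = tmap idfun Delta (Delta a).

Definition lact (a : A) : A ⊗ A -> A ⊗ A :=
  tmap (mu \o tens a) idfun.

Definition ract (a : A) : A ⊗ A -> A ⊗ A :=
  tmap idfun (mu \o tensr a).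

HB.instance Definition _ (a : A) := GRing.Linear.on (lact a).
HB.instance Definition _ (a : A) := GRing.Linear.on (ract a).

Lemma lactE a b c : lact a (b ⊗ₜ c) = mu (a ⊗ₜ b) ⊗ₜ c.
Proof. exact: tmapE. Qed.

Lemma ractE a b c : ract a (b ⊗ₜ c) = b ⊗ₜ mu (c ⊗ₜ a).
Proof. exact: tmapE. Qed.

Record inf_bialgebra (lambda : k) : Prop := InfBialgebra {
  inf_bialgebra_assoc : mul_assoc;
  inf_bialgebra_coassoc : comul_coassoc;
  inf_bialgebra_compat : forall a b : A,
    Delta (mu (a ⊗ₜ b)) =
      lact a (Delta b) + ract b (Delta a) + lambda *: (a ⊗ₜ b)
}.

End InfinitesimalBialgebra.

(* Main.v *)
Require Import Defs.
From mathcomp Require Import all_boot ssralg.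

Set Implicit Arguments.
Unset Strict Implicit.
Unset Printing Implicit Defensive.

(** The canonical map dual_tens : A^* ⊗ A^* -> (A ⊗ A)^* lets an element of
    A^* ⊗ A^* be tested against elements of A ⊗ A, and it is injective by
    hypothesis.  So every axiom for A^* can be checked after evaluation, where it
    becomes the transpose of an axiom for A.

    Two facts make the evaluations mechanical: dual_tens is natural
    ([dual_tens_transpose]), and it is compatible with reassociation of triple
    tensors ([dual_tens_tassoc]).  Associativity of the product of A^* is then
    the transpose of the coassociativity of Delta.  Coassociativity of the
    coproduct is the transpose of the associativity of mu; here the
    identity is to be proved in a triple tensor product, so it is the injectivity
    of dual_tens3 that is used, after writing one side as the
    reassociation of some element ([tassoc_surj]).

    In the compatibility condition, transposition exchanges the two actions: the
    left action of f on the coproduct of g, tested on x ⊗ y, is f ⊗ g tested on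
    the right action of y on Delta x, and symmetrically ([dual_lact],
    [dual_ract]).  The term weighted by lambda is its own transpose. *)

Local Open Scope ring_scope.
Import GRing.Theory.

(** * Generation of tensor products by pure tensors *)

Lemma tensor_ind (k : comPzRingType) (M N : lmodType k) (P : M ⊗ N -> Prop) :
  P 0 -> (forall s t, P s -> P t -> P (s + t)) -> (forall x y, P (x ⊗ₜ y)) ->
  forall t, P t.
Proof.
move=> P0 PD Pt t; rewrite [t]tensor_sum.
by elim/big_ind: _ => // -[x y] _; apply: Pt.
Qed.

Lemma tensor3_ind (k : comPzRingType) (M N Q : lmodType k)
    (P : M ⊗ N ⊗ Q -> Prop) :
  P 0 -> (forall s t, P s -> P t -> P (s + t)) ->
  (forall x y z, P (x ⊗ₜ y ⊗ₜ z)) -> forall t, P t.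
Proof.
move=> P0 PD Pt; apply: tensor_ind => // + z; apply: tensor_ind => //.
- by have -> : 0 ⊗ₜ z = 0 :> M ⊗ N ⊗ Q by exact: (linear0 (tensr z)).
- move=> s t Ps Pt'.
  have -> : (s + t) ⊗ₜ z = s ⊗ₜ z + t ⊗ₜ z by exact: (linearD (tensr z)).
  exact: PD.
Qed.

(** Surjectivity is what lets an identity in M ⊗ (N ⊗ P) be pulled back to
    M ⊗ N ⊗ P, without constructing the inverse of [tassoc]. *)
Lemma tassoc_surj (k : comPzRingType) (M N P : lmodType k)
    (t : M ⊗ (N ⊗ P)) : exists v : M ⊗ N ⊗ P, tassoc v = t.
Proof.
elim/tensor_ind: t => [|s t [v <-] [w <-]|x u].
- by exists 0; rewrite linear0.
- by exists (v + w); rewrite linearD.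
elim/tensor_ind: u => [|s t [v vE] [w wE]|y z].
- by exists 0; rewrite !linear0.
- by exists (v + w); rewrite !linearD /= vE wE.
- by exists (x ⊗ₜ y ⊗ₜ z); exact: tassocE.
Qed.

Lemma tmap_comp (k : comPzRingType) (M M' M'' N N' N'' : lmodType k)
    (f' : {linear M' -> M''}) (f : {linear M -> M'})
    (g' : {linear N' -> N''}) (g : {linear N -> N'}) t :
  tmap f' g' (tmap f g t) = tmap (f' \o f) (g' \o g) t.
Proof.
elim/tensor_ind: t => [|s t IHs IHt|x y]; first by rewrite !linear0.
- by rewrite !linearD /= IHs IHt.
- by rewrite !tmapE.
Qed.

Lemma eq_tmap (k : comPzRingType) (M M' N N' : lmodType k)
    (f f' : {linear M -> M'}) (g g' : {linear N -> N'}) :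
  f =1 f' -> g =1 g' -> tmap f g =1 tmap f' g'.
Proof. by move=> ff' gg'; apply: tlift_unique => x y; rewrite /= !tmapE ff' gg'. Qed.

(** * The canonical map from a tensor product of duals *)

Lemma dual_tens_transpose (k : comPzRingType) (M M' N N' : lmodType k)
    (u : {linear M -> M'}) (v : {linear N -> N'}) t w :
  dual_tens M N (tmap (transpose u) (transpose v) t) w =
  dual_tens M' N' t (tmap u v w).
Proof.
elim/tensor_ind: t => [|s t IHs IHt|f g]; first by rewrite !linear0.
- by rewrite !linearD /= IHs IHt.
elim/tensor_ind: w => [|s t IHs IHt|x y]; first by rewrite !linear0.
- by rewrite !linearD /= IHs IHt.
- by rewrite !tmapE !dual_tensE.
Qed.

Lemma dual_tens_tassoc (k : comPzRingType) (M N P : lmodType k) v w :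
  dual_tens M (N ⊗ P) (tmap idfun (dual_tens N P) (tassoc v)) (tassoc w) =
  dual_tens3 M N P v w.
Proof.
elim/tensor3_ind: v => [|s t IHs IHt|f g h]; first by rewrite !linear0.
- by rewrite !linearD /= IHs IHt.
elim/tensor3_ind: w => [|s t IHs IHt|x y z]; first by rewrite !linear0.
- by rewrite !linearD /= IHs IHt.
- by rewrite !tassocE tmapE dual_tens3E !dual_tensE mulrA.
Qed.

Lemma transpose_id (k : comPzRingType) (M : lmodType k) :
  transpose (idfun : {linear M -> M}) =1 idfun.
Proof. by move=> f; apply: dualP. Qed.

(** Naturality in one factor.  The map u' only has to agree pointwise with a
    transpose, so that it may be a composite such as dual_tens after the coproduct
    of the dual, which is a transpose because dual_tens_inv is inverse to
    dual_tens. *)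
Lemma dual_tens_transposel (k : comPzRingType) (M M' N : lmodType k)
    (u : {linear M -> M'}) (u' : {linear dual M' -> dual M}) t w :
  u' =1 transpose u ->
  dual_tens M N (tmap u' idfun t) w = dual_tens M' N t (tmap u idfun w).
Proof.
move=> u'E; rewrite -dual_tens_transpose; congr (dual_tens _ _ _ w).
by apply: eq_tmap => // f; exact/esym/transpose_id.
Qed.

Lemma dual_tens_transposer (k : comPzRingType) (M N N' : lmodType k)
    (v : {linear N -> N'}) (v' : {linear dual N' -> dual N}) t w :
  v' =1 transpose v ->
  dual_tens M N (tmap idfun v' t) w = dual_tens M N' t (tmap idfun v w).
Proof.
move=> v'E; rewrite -dual_tens_transpose; congr (dual_tens _ _ _ w).
by apply: eq_tmap => // f; exact/esym/transpose_id.
Qed.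

(** * The transposed structure *)

Lemma mul_assoc_tassoc (k : comPzRingType) (A : lmodType k)
    (mu : {linear A ⊗ A -> A}) : mul_assoc mu ->
  forall w, mu (tmap mu idfun w) = mu (tmap idfun mu (tassoc w)).
Proof.
move=> muA w; elim/tensor3_ind: w => [|s t IHs IHt|x y z].
- by rewrite !linear0.
- by rewrite !linearD /= IHs IHt.
- by rewrite tassocE !tmapE /= muA.
Qed.

Section TransposedActions.
Variables (k : comPzRingType) (A : lmodType k).
Variables (mu : {linear A ⊗ A -> A}) (Delta : {linear A -> A ⊗ A}).

Let dmul : {linear dual A ⊗ dual A -> dual A} :=
  transpose Delta \o dual_tens A A.

Lemma dmul_assoc : comul_coassoc Delta -> mul_assoc dmul.
Proof.
move=> DA f g h; apply: dualP => a.
transitivity (dual_tens3 A A A (f ⊗ₜ g ⊗ₜ h) (tmap Delta idfun (Delta a))).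
  rewrite /dual_tens3 /= -(dual_tens_transposel (u' := transpose Delta)) //.
  by rewrite !tmapE.
rewrite -dual_tens_tassoc DA tassocE tmapE.
by rewrite -(dual_tens_transposer (v' := transpose Delta)) // tmapE.
Qed.

Lemma dual_lact_tens f u x y :
  dual_tens A A (lact dmul f u) (x ⊗ₜ y) =
  dual_tens A A (f ⊗ₜ transpose (tensr y) (dual_tens A A u)) (Delta x).
Proof.
elim/tensor_ind: u => [|s t IHs IHt|g h]; first by rewrite !linear0.
- by rewrite !linearD /= IHs IHt.
rewrite lactE dual_tensE /=; elim/tensor_ind: (Delta x) => [|s t IHs IHt|a b].
- by rewrite !linear0 mul0r.
- by rewrite !linearD /= mulrDl IHs IHt.
- by rewrite !dual_tensE /= dual_tensE mulrA.
Qed.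

Lemma dual_ract_tens f u x y :
  dual_tens A A (ract dmul f u) (x ⊗ₜ y) =
  dual_tens A A (transpose (tens x) (dual_tens A A u) ⊗ₜ f) (Delta y).
Proof.
elim/tensor_ind: u => [|s t IHs IHt|g h].
- by rewrite !linear0; have -> : 0 ⊗ₜ f = 0 := linear0 (tensr f); rewrite linear0.
- rewrite !linearD /= IHs IHt.
  set p := transpose _ _; set q := transpose _ _.
  have -> : (p + q) ⊗ₜ f = p ⊗ₜ f + q ⊗ₜ f by exact: (linearD (tensr f)).
  by rewrite linearD.
rewrite ractE dual_tensE /=; elim/tensor_ind: (Delta y) => [|s t IHs IHt|a b].
- by rewrite !linear0 mulr0.
- by rewrite !linearD /= mulrDr IHs IHt.
- by rewrite !dual_tensE /= dual_tensE mulrA.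
Qed.

(** In Sweedler notation, with u the coproduct of g, both sides are the sum of
    the f(x1) g(x2 y): transposition turns a left action into a right one. *)
Lemma dual_lact f g u x y : dual_tens A A u = transpose mu g ->
  dual_tens A A (lact dmul f u) (x ⊗ₜ y) =
  dual_tens A A (f ⊗ₜ g) (ract mu y (Delta x)).
Proof.
move=> uE; rewrite dual_lact_tens uE /ract.
rewrite -(dual_tens_transposer (v' := transpose (mu \o tensr y))) // tmapE.
by congr (dual_tens _ _ (_ ⊗ₜ _) _); apply: dualP.
Qed.

Lemma dual_ract f g u x y : dual_tens A A u = transpose mu f ->
  dual_tens A A (ract dmul g u) (x ⊗ₜ y) =
  dual_tens A A (f ⊗ₜ g) (lact mu x (Delta y)).
Proof.
move=> uE; rewrite dual_ract_tens uE /lact.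
rewrite -(dual_tens_transposel (u' := transpose (mu \o tens x))) // tmapE.
by congr (dual_tens _ _ (_ ⊗ₜ _) _); apply: dualP.
Qed.

End TransposedActions.

Theorem theorem2p19 (k : comPzRingType) (lambda : k) (A : lmodType k)
    (mu : {linear A ⊗ A -> A}) (Delta : {linear A -> A ⊗ A})
    (dual_tens_inv : {linear dual (A ⊗ A) -> dual A ⊗ dual A}) :
  inf_bialgebra mu Delta lambda ->
  cancel (dual_tens A A) dual_tens_inv ->
  cancel dual_tens_inv (dual_tens A A) ->
  injective (dual_tens3 A A A) ->
  inf_bialgebra (transpose Delta \o dual_tens A A)
                (dual_tens_inv \o transpose mu) lambda.
Proof.
move=> [muA DeltaA compat] dtK dtVK dt3_inj; split.
- exact: dmul_assoc.
- (* Both sides, tested on w, are f applied to a triple product of w, bracketed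
     in the two ways. *)
  move=> f; set D : {linear dual A -> _} := dual_tens_inv \o transpose mu.
  have DE : (dual_tens A A \o D : {linear _ -> _}) =1 transpose mu.
    by move=> g; exact: dtVK.
  have [v vE] := tassoc_surj (tmap idfun D (D f)).
  rewrite -vE; congr tassoc; apply: dt3_inj; apply: dualP => w.
  rewrite -(dual_tens_tassoc v) vE /dual_tens3 /= !tmap_comp.
  rewrite (dual_tens_transposel (u := mu)) // (dual_tens_transposer (v := mu)) //.
  by rewrite !dtVK /= mul_assoc_tassoc.
- move=> f g; apply: (can_inj dtK); apply: dualP.
  apply: tlift_unique => x y.
  rewrite /= dtVK /= compat !linearD !linearZ /=.
  rewrite (dual_lact _ _ _ _ (dtVK (transpose mu g))).
  rewrite (dual_ract _ _ _ _ (dtVK (transpose mu f))).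
  by rewrite [X in X + _]addrC !dual_tensE.
Qed.
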